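(* For a composition $\alpha$, write $\rho(\psi_\alpha)=\sum_\beta c_\beta\psi_\beta$. Then for every composition $\beta$, $c_\beta=\mathrm{MaxOne}^{\otimes l(\beta)}\Delta_{\beta^{\mathrm{rev}}}(\psi_\alpha)$.
   Context: $\mathrm{QSym}$ is the algebra of quasisymmetric functions over $\mathbb{C}$, with monomial basis $M_\alpha=\sum_{i_1<\dots<i_k}x_{i_1}^{\alpha_1}\cdots x_{i_k}^{\alpha_k}$ and fundamental basis $L_\alpha=\sum_{\beta\text{ refines }\alpha}M_\beta$. For a composition $\alpha$ of length $l(\alpha)$, $\alpha^{\mathrm{rev}}$ is its reversal. Let $\pi(\alpha)=\prod_{i=1}^{l}(\alpha_1+\cdots+\alpha_i)$; if $\alpha$ refines $\beta$, let $\alpha^{(i)}$ be the parts of $\alpha$ summing to $\beta_i$ and $\pi(\alpha,\beta)=\prod_i\pi(\alpha^{(i)})$. Define $\psi_\alpha=\sum_{\beta\text{ coarsens }\alpha}\frac{1}{\pi(\alpha,\beta)}M_\beta$. $\rho$ is the linear automorphism of $\mathrm{QSym}$ with $\rho(L_\alpha)=L_{\alpha^{\mathrm{rev}}}$. $\mathrm{MaxOne}$ is the linear functional with $\mathrm{MaxOne}(L_\alpha)=(-1)^k$ if $\alpha=(n-k,1^k)$ for some $0\le k<n$ and $0$ otherwise. The coproduct is $\Delta(M_\alpha)=\sum_{\beta\cdot\gamma=\alpha}M_\beta\otimes M_\gamma$ (deconcatenation, $M_\varnothing=1$), and for a composition $\gamma$ of length $l$, $\Delta_\gamma$ is the $(l-1)$-fold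 iterated coproduct followed by projection onto $\mathrm{QSym}_{\gamma_1}\otimes\cdots\otimes\mathrm{QSym}_{\gamma_l}$. *)

(* Defs.v *)
From HB Require Import structures.
From mathcomp Require Import all_boot all_order all_algebra.
From mathcomp Require Import finmap.
From mathcomp Require Import mathcomp_extra boolp classical_sets functions.
From mathcomp Require Import reals complex monalg zify.

Set Implicit Arguments.
Unset Strict Implicit.
Unset Printing Implicit Defensive.

Import GRing.Theory.

Record composition := Composition {
  parts :> seq nat;
  parts_gt0 : all (leq 1) parts }.

HB.instance Definition _ := [isSub for parts].
HB.instance Definition _ := [Choice of composition by <:].

Lemma crev_subproof (a : composition) : all (leq 1) (rev a).
Proof. by rewrite all_rev parts_gt0. Qed.
Definition crev a := Composition (crev_subproof a).

Lemma ctake_subproof k (a : composition) : all (leq 1) (take k a).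
Proof. by apply/allP => x /mem_take; apply/allP/parts_gt0. Qed.
Definition ctake k a := Composition (ctake_subproof k a).

Lemma cdrop_subproof k (a : composition) : all (leq 1) (drop k a).
Proof. by apply/allP => x /mem_drop; apply/allP/parts_gt0. Qed.
Definition cdrop k a := Composition (cdrop_subproof k a).

Definition cnil : composition := @Composition [::] isT.

Fixpoint compseqs (n : nat) : seq (seq nat) :=
  if n is n'.+1 then
    flatten [seq if s is h :: t then [:: 1 :: s; h.+1 :: t] else [:: [:: 1]]
            | s <- compseqs n']
  else [:: [::]].

Definition comps (n : nat) : seq composition := pmap insub (compseqs n).

Lemma compseqs_gt0 n s : s \in compseqs n -> all (leq 1) s.
Proof.
elim: n s => [|n IHn] s /=; first by rewrite inE => /eqP ->.
case/flattenP => u /mapP[t /IHn]; case: t => [|h t] /= tP ->.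
  by rewrite inE => /eqP ->.
by rewrite !inE => /orP[] /eqP -> //=; case/andP: tP.
Qed.

Lemma mem_compseqs n s : (s \in compseqs n) = all (leq 1) s && (sumn s == n).
Proof.
apply/idP/andP => [sn|[s0 /eqP <-]]; first split; first exact: compseqs_gt0 sn.
  elim: n s sn => [|n IHn] s /=; first by rewrite inE => /eqP ->.
  case/flattenP => u /mapP[t /IHn /eqP tn ->]; case: t tn => [|h t] /= <-.
    by rewrite inE => /eqP ->.
  by rewrite !inE => /orP[] /eqP -> /=.
move: s s0; clear n; suff H n s : sumn s = n -> all (leq 1) s -> s \in compseqs n.
  by move=> s; apply: H.
elim: n s => [|n IHn] [|[|[|h]] s] //= sn.
- move=> s0; apply/flattenP.
  exists (if s is h :: t then [:: 1 :: s; h.+1 :: t] else [:: [:: 1]]).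
    by apply/mapP; exists s => //; apply: IHn => //; case: sn.
  by case: s {sn s0} => [|h t]; rewrite !inE eqxx.
- move=> s0; apply/flattenP; exists [:: [:: 1, h.+1 & s]; h.+2 :: s].
    by apply/mapP; exists (h.+1 :: s) => //; apply: IHn => //; case: sn.
  by rewrite !inE eqxx orbT.
Qed.

Lemma uniq_compseqs n : uniq (compseqs n).
Proof.
elim: n => [//|n IHn] /=.
have pos s : s \in compseqs n -> all (leq 1) s by apply: compseqs_gt0.
elim: (compseqs n) IHn pos => [//|s l IHl] /= /andP[sl ul] pos.
have s0 : all (leq 1) s by apply: pos; rewrite mem_head.
have l0 t : t \in l -> all (leq 1) t by move=> tl; apply: pos; rewrite inE tl orbT.
rewrite cat_uniq IHl // andbT; apply/andP; split; first by case: s {sl pos} s0 => [|[|h] t].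
apply/hasPn => x /flattenP[u /mapP[t tl ->]] xu; apply/negP => xs.
case: s sl s0 xs {pos IHl} => [|h s] sl s0; rewrite !inE => xs; move/l0: (tl) => t0;
  (have nst : t <> h :: s by move=> ts; rewrite -ts tl in sl) ||
  (have nst : t <> [::] by move=> ts; rewrite -ts tl in sl);
  case: t {tl} nst t0 xu => [|g t] nst t0; rewrite !inE => xu.
- exact: nst.
- by case/orP: xu xs => /eqP-> /eqP[] //; case: g {nst} t0.
- by move: xs; rewrite (eqP xu) => /orP[] /eqP[] // h0; rewrite -h0 in s0.
case/orP: xu xs => /eqP-> /orP[] /eqP[].
- by move=> gh ts; apply: nst; rewrite gh ts.
- by move=> h0; rewrite -h0 in s0.
- by move=> h0; rewrite h0 in t0.
- by move=> gh ts; apply: nst; rewrite gh ts.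
Qed.

Lemma mem_comps n (a : composition) : (a \in comps n) = (sumn a == n).
Proof. by rewrite mem_pmap_sub mem_compseqs parts_gt0. Qed.

Lemma uniq_comps n : uniq (comps n).
Proof. exact/pmap_sub_uniq/uniq_compseqs. Qed.

(* [blocks s b] cuts s greedily into consecutive runs, the i-th one being the
   shortest with sum at least b_i; by [refinesP] and [blocksK] these are the
   runs with sums b_1, b_2, ... whenever such a decomposition of s exists.    *)
Fixpoint cut_sum (n : nat) (s : seq nat) : seq nat * seq nat :=
  if s is x :: s' then
    if n is 0 then ([::], s) else
    let: (u, v) := cut_sum (n - x) s' in (x :: u, v)
  else ([::], [::]).

Fixpoint blocks (s b : seq nat) : seq (seq nat) :=
  if b is n :: b' then
    let: (u, v) := cut_sum n s in u :: blocks v b'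
  else [::].

(* [refines a b]: a refines b, i.e. b coarsens a. *)
Definition refines (a b : composition) : bool :=
  (flatten (blocks a b) == a) && ([seq sumn s | s <- blocks a b] == b).

Lemma cut_sum_cat u v : all (leq 1) u -> cut_sum (sumn u) (u ++ v) = (u, v).
Proof.
elim: u => [_|[//|x] u IHu] /=; first by case: v.
by move=> u0; rewrite addSn -addSn addKn IHu.
Qed.

Lemma blocksK B : all (leq 1) (flatten B) ->
  blocks (flatten B) [seq sumn s | s <- B] = B.
Proof.
elim: B => [//|u B IHB] /=; rewrite all_cat => /andP[u0 B0].
by rewrite cut_sum_cat // IHB.
Qed.

Lemma refinesP (a b : composition) :
  reflect (exists B, flatten B = a /\ [seq sumn s | s <- B] = b) (refines a b).
Proof.
apply: (iffP andP) => [[/eqP aB /eqP bB]|[B [aB bB]]]; first by exists (blocks a b).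
by rewrite -aB -bB blocksK ?aB ?parts_gt0 // !eqxx.
Qed.

Definition pi1 (s : seq nat) : nat := \prod_(1 <= i < (size s).+1) sumn (take i s).
Definition pi2 (a b : composition) : nat := \prod_(s <- blocks a b) pi1 s.

(* The monomial x_{i_1}^{a_1} ... x_{i_k}^{a_k}. *)
Definition xmon (i a : seq nat) : {cmonom nat} :=
  \big[mmul/mone]_(p <- zip i a) expcmn (ucm p.1) p.2.

Lemma expcmn_ucmE i n k : expcmn (@ucm nat i) n k = (i == k) * n :> nat.
Proof.
elim: n => [|n IHn]; first by rewrite /expcmn /= onecmE muln0.
have -> : expcmn (ucm i) n.+1 = mulcm (ucm i) (expcmn (ucm i) n).
  by case: n {IHn} => [|n] //=; rewrite /expcmn /= mulcm0.
by rewrite mulcmE ucmE IHn mulnS.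
Qed.

Lemma xmonE i a k : uniq i -> size i = size a ->
  xmon i a k = nth 0 a (index k i) :> nat.
Proof.
rewrite /xmon; elim: i a => [|x i IHi] [|y a] //=; first by rewrite big_nil cm1.
move=> /andP[xi ui] [sz]; rewrite big_cons cmM IHi // expcmn_ucmE.
case: eqP => [<-|_]; last by rewrite mul0n.
by rewrite mul1n memNindex // sz nth_default ?addn0.
Qed.

Lemma sorted_ltn_uniq i : sorted ltn i -> uniq i.
Proof. by apply: sorted_uniq; [exact: ltn_trans|exact: ltnn]. Qed.

Lemma xmon_inj (a b : composition) i j : sorted ltn i -> sorted ltn j ->
  size i = size a -> size j = size b -> xmon i a = xmon j b -> i = j /\ a = b.
Proof.
move=> si sj za zb E.
have ui := sorted_ltn_uniq si; have uj := sorted_ltn_uniq sj.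
have memE (c : composition) l : sorted ltn l -> size l = size c ->
    forall k, (k \in l) = (xmon l c k != 0)%N.
  move=> sl zc k; rewrite xmonE ?sorted_ltn_uniq //.
  case kl: (k \in l).
    have /(all_nthP 0)/(_ (index k l)) := parts_gt0 c.
    by rewrite -zc index_mem kl lt0n => ->.
  by rewrite memNindex ?kl // zc nth_default ?eqxx.
have ij : i = j.
  apply: (irr_sorted_eq ltn_trans ltnn) => // k.
  by rewrite (memE a) // (memE b) // E.
split=> //; apply: val_inj; rewrite /= -{}ij in sj uj zb E *.
apply: (@eq_from_nth _ 0); rewrite -?za -?zb // => k ki.
have := congr1 (fun m : {cmonom nat} => m (nth 0 i k)) E.
by rewrite /= !xmonE // index_uniq.
Qed.

Lemma xmon_surj (m : {cmonom nat}) :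
  exists (a : composition) i, [/\ sorted ltn i, size i = size a & m = xmon i a].
Proof.
pose i := sort leq (finsupp m).
have ui : uniq i by rewrite sort_uniq fset_uniq.
have si : sorted ltn i.
  rewrite ltn_sorted_uniq_leq ui /=; exact/sort_sorted/leq_total.
have m0 : all (leq 1) [seq m k | k <- i].
  apply/allP => _ /mapP[k + ->]; rewrite mem_sort -cmE_neq0; by rewrite lt0n.
exists (Composition m0), i; split=> //=; first by rewrite size_map.
apply/eqP/cmP => k; rewrite xmonE ?size_map //=.
case ki: (k \in i); first by rewrite (nth_map 0) ?index_mem // nth_index.
rewrite memNindex ?ki // nth_default ?size_map //; apply/eqP.
by rewrite cmE_eq0 -(mem_sort leq) ki.
Qed.

Lemma mdeg_xmon i a : size i = size a -> mdeg (xmon i a) = sumn a.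
Proof.
rewrite /xmon mdeg_prod; elim: i a => [|x i IHi] [|y a] //=; first by rewrite big_nil.
move=> [sz]; rewrite big_cons IHi //; congr addn.
rewrite (@mdegEw _ _ [fset x]%fset); first by rewrite big_seq_fset1 expcmn_ucmE eqxx mul1n.
apply/fsubsetP => k; rewrite -cmE_neq0 expcmn_ucmE in_fset1 [x == k]eq_sym.
by case: (k == x).
Qed.

Local Open Scope ring_scope.

Definition bounded_degree (K : fieldType) (f : {cmonom nat} -> K^o) : Prop :=
  exists d, forall m, f m != 0 -> (mdeg m <= d)%N.

Definition quasisymmetric (K : fieldType) (f : {cmonom nat} -> K^o) : Prop :=
  forall (a : composition) (i j : seq nat),
    sorted ltn i -> sorted ltn j -> size i = size a -> size j = size a ->
    f (xmon i a) = f (xmon j a).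

Definition qsym_pred (K : fieldType) : {pred {cmonom nat} -> K^o} :=
  fun f => `[< bounded_degree f /\ quasisymmetric f >].

Record QSym (K : fieldType) := MkQSym {
  qser :> {cmonom nat} -> K^o;
  qserP : qser \in @qsym_pred K }.

Section QSymTheory.
Variable K : fieldType.

Lemma qsym_submod_closed : submod_closed (@qsym_pred K).
Proof.
split=> [|c f g /asboolP[[d fd] fq] /asboolP[[e ge] gq]]; apply/asboolP; split.
- by exists 0%N => m; rewrite /GRing.zero /= eqxx.
- by [].
- exists (maxn d e) => m; have fgE : (c *: f + g) m = c * f m + g m by [].
  rewrite fgE leq_max => h; apply/orP.
  have [f0|/fd ->] := eqVneq (f m) 0; last by left.
  have [g0|/ge ->] := eqVneq (g m) 0; last by right.
  by rewrite f0 g0 mulr0 addr0 eqxx in h.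
- move=> a i j si sj zi zj; have fgE m : (c *: f + g) m = c * f m + g m by [].
  by rewrite !fgE (fq _ i j) // (gq _ i j).
Qed.

HB.instance Definition _ :=
  GRing.isSubmodClosed.Build K _ (@qsym_pred K) qsym_submod_closed.
HB.instance Definition _ := [isSub for @qser K].
HB.instance Definition _ := [Choice of QSym K by <:].
HB.instance Definition _ := [SubChoice_isSubLmodule of QSym K by <:].

End QSymTheory.

Section LinearExtension.
Variables (K : fieldType) (B : choiceType) (V : lmodType K) (f : B -> V).

(* The linear map with <<b>> |-> f b on the free module {malg K[B]}. *)
Definition linext (x : {malg K[B]}) : V := \sum_(b <- msupp x) x@_b *: f b.

Lemma linextEw (D : {fset B}) x : (msupp x `<=` D)%fset ->
  linext x = \sum_(b <- D) x@_b *: f b.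
Proof.
move=> xD; rewrite /linext (big_fset_incl _ xD) // => b _ /mcoeff_outdom ->.
exact: scale0r.
Qed.

Lemma linext_is_linear : linear linext.
Proof.
move=> c x y; pose D := (msupp x `|` msupp y)%fset.
have xD : (msupp x `<=` D)%fset by exact: fsubsetUl.
have yD : (msupp y `<=` D)%fset by exact: fsubsetUr.
have cD : (msupp (c *: x + y) `<=` D)%fset.
  apply: fsubset_trans (msuppD_le _ _) _; rewrite fsubUset yD andbT.
  exact: fsubset_trans (msuppZ_le _ _) xD.
rewrite !(@linextEw D) // scaler_sumr -big_split; apply: eq_bigr => b _ /=.
by rewrite mcoeffD mcoeffZ scalerDl scalerA.
Qed.

HB.instance Definition _ :=
  GRing.isLinear.Build K {malg K[B]} V *:%R linext linext_is_linear.

Lemma linextU b : linext << b >> = f b.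
Proof. by rewrite /linext msuppU oner_eq0 big_seq_fset1 mcoeffUU scale1r. Qed.

End LinearExtension.

Section Bases.
Variable K : fieldType.

(* For a fixed a, distinct i give distinct monomials [xmon i a], so every
   coefficient of M_a is 0 or 1.                                              *)
Definition Mser (a : composition) : {cmonom nat} -> K^o := fun m =>
  `[< exists i, [/\ sorted ltn i, size i = size a & m = xmon i a] >]%:R.

Lemma Mser_xmon (a b : composition) i : sorted ltn i -> size i = size b ->
  Mser a (xmon i b) = (a == b)%:R.
Proof.
move=> si zi; rewrite /Mser; congr (_%:R); case: asboolP => [[j [sj zj]]|].
  by case/(xmon_inj si sj zi zj) => _ ->; rewrite eqxx.
by case: eqP => // -> []; exists i.
Qed.

Lemma Mser_subproof a : Mser a \in @qsym_pred K.
Proof.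
apply/asboolP; split; last by move=> b i j si sj zi zj; rewrite !Mser_xmon.
exists (sumn a) => m; rewrite /Mser; case: asboolP; last by rewrite eqxx.
by case=> i [_ zi ->] _; rewrite mdeg_xmon.
Qed.

Definition M (a : composition) : QSym K := MkQSym (Mser_subproof a).

Definition L (a : composition) : QSym K :=
  \sum_(b <- comps (sumn a) | refines b a) M b.

Definition psi (a : composition) : QSym K :=
  \sum_(b <- comps (sumn a) | refines a b) (pi2 a b)%:R^-1 *: M b.

Definition Mcoef (f : QSym K) (a : composition) : K :=
  f (xmon (iota 0 (size a)) a).

Lemma Mcoef_bounded (f : QSym K) :
  exists d, forall a, Mcoef f a != 0 -> (sumn a <= d)%N.
Proof.
have /asboolP[[d fd] _] := qserP f; exists d => a /fd.
by rewrite mdeg_xmon ?size_iota.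
Qed.

Definition Mbound (f : QSym K) : nat := projT1 (cid (Mcoef_bounded f)).

(* The coordinates of f in the monomial basis. *)
Definition Mcoords (f : QSym K) : {malg K[composition]} :=
  [malg a in [fset a in flatten [seq comps n | n <- iota 0 (Mbound f).+1]]%fset
     => Mcoef f a].

Lemma McoordsE f a : (Mcoords f)@_a = Mcoef f a.
Proof.
rewrite mcoeffE in_fset; case: ifPn => // /negP aD; symmetry; apply/eqP.
apply: contra_notT aD => /(projT2 (cid (Mcoef_bounded f))) ad; apply/flattenP.
exists (comps (sumn a)); last by rewrite mem_comps.
by apply/map_f; rewrite mem_iota.
Qed.

Lemma Mcoords_is_linear : linear Mcoords.
Proof. by move=> c f g; apply/malgP => a; rewrite mcoeffD mcoeffZ !McoordsE. Qed.

HB.instance Definition _ :=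
  GRing.isLinear.Build K (QSym K) {malg K[composition]} *:%R Mcoords
    Mcoords_is_linear.

Lemma sorted_iota0 n : sorted ltn (iota 0 n).
Proof. exact: iota_ltn_sorted. Qed.

Lemma McoordsM a : Mcoords (M a) = << a >>.
Proof.
apply/malgP => b; rewrite McoordsE mcoeffU /Mcoef /=.
by rewrite Mser_xmon ?size_iota // sorted_iota0.
Qed.

Lemma qserD (f g : QSym K) m : (f + g : QSym K) m = f m + g m.
Proof. by []. Qed.

Lemma qserZ c (f : QSym K) m : (c *: f : QSym K) m = c * f m.
Proof. by []. Qed.

Lemma qser_sum (T : Type) (r : seq T) (F : T -> QSym K) m :
  (\sum_(t <- r) F t : QSym K) m = \sum_(t <- r) F t m.
Proof. exact: (big_morph (fun f : QSym K => f m)). Qed.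

Lemma McoordsK : cancel Mcoords (linext M).
Proof.
move=> f; apply: val_inj; apply/funext => m /=.
have [a [i [si zi ->]]] := xmon_surj m.
have -> : f (xmon i a) = Mcoef f a.
  have /asboolP[_ fq] := qserP f.
  by apply: fq; rewrite ?size_iota // sorted_iota0.
rewrite /linext qser_sum -McoordsE.
transitivity (\sum_(b <- msupp (Mcoords f)) (Mcoords f)@_b * (b == a)%:R).
  by apply: eq_bigr => b _; rewrite qserZ /= Mser_xmon.
case: (msuppP (Mcoords f) a) => h.
  rewrite (big_fsetD1 a) //= eqxx mulr1 big1_fset ?addr0 // => b.
  by rewrite in_fsetD1 => /andP[/negPf -> _] _; rewrite mulr0.
apply: big1_fset => b bf _; case: eqP => [ba|]; last by rewrite mulr0.
by rewrite -ba bf in h.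
Qed.

Lemma linextMK : cancel (linext M) Mcoords.
Proof.
move=> x; rewrite /linext raddf_sum /= [RHS]monalgE; apply: eq_bigr => a _.
rewrite linearZ /= McoordsM; apply/malgP => b.
by rewrite mcoeffZ !mcoeffU mulr_natr.
Qed.

End Bases.

(* The tensor power QSym^{(x) l}, in coordinates: the basis vector
   << [tuple b_1; ...; b_l] >> stands for M_{b_1} (x) ... (x) M_{b_l}.        *)
Notation Tens K l := {malg K[l.-tuple composition]}.

Section Coproduct.
Variable K : fieldType.

(* Delta (x) id^{(x) l}; the pairs (b, c) of compositions with b.c = a are the
   (take k a, drop k a) with 0 <= k <= l(a).                                  *)
Definition comul_head (l : nat) : Tens K l.+1 -> Tens K l.+2 :=
  linext (fun t : l.+1.-tuple composition =>
    \sum_(k < (size (thead t)).+1)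
      << [tuple of ctake k (thead t) :: cdrop k (thead t) :: behead t] >>
      : Tens K l.+2).

(* [iter_comulS k] is the k-fold iterated coproduct QSym -> QSym^{(x) k+1}. *)
Fixpoint iter_comulS (k : nat) (f : QSym K) : Tens K k.+1 :=
  if k is k'.+1 then comul_head (iter_comulS k' f)
  else linext (fun a => << [tuple a] >> : Tens K 1) (Mcoords f).

(* The (l-1)-fold iterated coproduct QSym -> QSym^{(x) l}; for l = 0 it is the
   counit QSym -> QSym^{(x) 0} = K, i.e. the coefficient of M_{()} = 1.       *)
Definition iter_comul (l : nat) (f : QSym K) : Tens K l :=
  if l is k.+1 then iter_comulS k f else << Mcoef f cnil *g [tuple] >>.

(* Projection onto QSym_{g_1} (x) ... (x) QSym_{g_l}. *)
Definition proj_deg (g : composition) : Tens K (size g) -> Tens K (size g) :=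
  linext (fun t : (size g).-tuple composition =>
    (if [seq sumn b | b : composition <- t] == g then << t >> else 0)
      : Tens K (size g)).

Definition Delta (g : composition) (f : QSym K) : Tens K (size g) :=
  proj_deg (iter_comul (size g) f).

(* phi^{(x) l} : QSym^{(x) l} -> K^{(x) l} = K. *)
Definition tens_form (phi : QSym K -> K) (l : nat) : Tens K l -> K :=
  linext (fun t : l.-tuple composition => \prod_(b <- t) phi (M K b) : K^o).

Lemma iter_comul2_M a : iter_comul 2 (M K a) =
  \sum_(k < (size a).+1) << [tuple ctake k a; cdrop k a] >> :> Tens K 2.
Proof.
rewrite /= /comul_head McoordsM !linextU; apply: eq_bigr => k _.
by congr << _ >>; apply: val_inj.
Qed.

End Coproduct.

Lemma refines_weight a b : refines a b -> sumn a = sumn b.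
Proof.
by case/refinesP => B [<- <-]; elim: B => //= u B IHB; rewrite sumn_cat IHB.
Qed.

Lemma refines_refl a : refines a a.
Proof.
apply/refinesP; exists [seq [:: x] | x <- a]; split.
  by elim: (parts a) => //= x s ->.
by rewrite -map_comp -[RHS]map_id; apply: eq_map => x /=; rewrite addn0.
Qed.

Lemma refines_size a b : refines a b -> a != b -> (size b < size a)%N.
Proof.
case/refinesP => B []; rewrite -val_eqE /=.
have := parts_gt0 b; case: a => /= a _; case: b => /= b _ b0 aB bB.
rewrite -{a}aB -{}bB in b0 *.
suff [h1 h2] : (size B <= size (flatten B))%N /\
    (flatten B != [seq sumn s | s <- B] -> size B != size (flatten B)).
  by move=> /h2 ne; rewrite size_map ltn_neqAle ne.
elim: B b0 => [//|u B IHB] /= /andP[u0 /IHB[h1 h2]].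
case: u u0 => [//|x [|y u]] u0; rewrite /= ?addn0; split=> //.
- by rewrite eqseq_cons eqxx eqSS.
- by rewrite ltnS size_cat; apply: leq_trans h1 _; rewrite leqW ?leq_addl.
- by move=> _; rewrite eqSS neq_ltn size_cat ltnS (leq_trans h1) ?leq_addl.
Qed.

Lemma size_weight (a : composition) : (size a <= sumn a)%N.
Proof.
case: a => a /=; elim: a => //= x a IHa /andP[x0 a0].
by rewrite -add1n leq_add // IHa.
Qed.

Lemma refines_defect n (a b : composition) : refines b a -> b != a ->
  (sumn a - size a <= n.+1)%N -> (sumn b - size b <= n)%N.
Proof.
move=> ba bna; rewrite (refines_weight ba); have := refines_size ba bna.
by have := size_weight b; rewrite (refines_weight ba); lia.
Qed.

Lemma refines_defect0 (a b : composition) : refines b a -> b != a ->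
  (sumn a - size a <= 0)%N -> False.
Proof.
move=> ba bna; have := refines_size ba bna; have := size_weight b.
by rewrite (refines_weight ba); lia.
Qed.

Lemma sum_refines (V : zmodType) (a : composition) (F : composition -> V) :
  \sum_(b <- comps (sumn a) | refines b a) F b =
  F a + \sum_(b <- comps (sumn a) | refines b a && (b != a)) F b.
Proof.
rewrite big_mkcond (bigD1_seq a) ?mem_comps ?uniq_comps //= refines_refl.
congr (_ + _); rewrite [LHS]big_mkcond [RHS]big_mkcond; apply: eq_bigr => b _.
by case: refines; case: (b == a).
Qed.

(* The fundamental functions form a basis: any prescription of values on them
   extends to a linear map, and this extension is unique.                     *)
Section LExtension.
Variables (K : fieldType) (V : lmodType K) (v : composition -> V).

Fixpoint Ldual (n : nat) (a : composition) : V :=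
  v a - if n is n'.+1 then
          \sum_(b <- comps (sumn a) | refines b a && (b != a)) Ldual n' b
        else 0.

Lemma Ldual_stable n m (a : composition) :
  (sumn a - size a <= n)%N -> (sumn a - size a <= m)%N -> Ldual n a = Ldual m a.
Proof.
elim: n m a => [|n IHn] [|m] a //=.
- move=> a0 _; rewrite big_pred0 // => b.
  by apply/negP => /andP[ba bna]; exact: refines_defect0 bna a0.
- move=> _ a0; rewrite big_pred0 // => b.
  by apply/negP => /andP[ba bna]; exact: refines_defect0 bna a0.
move=> an am; congr (_ - _); apply: eq_bigr => b /andP[ba bna].
by apply: IHn; apply: refines_defect bna _.
Qed.

Lemma Ldual_sum (a : composition) :
  \sum_(b <- comps (sumn a) | refines b a) Ldual (sumn b - size b) b = v a.
Proof.
rewrite sum_refines.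
rewrite (@Ldual_stable _ (sumn a - size a).+1 a) //=.
rewrite -[RHS]addr0 -addrA; congr (_ + _); apply/eqP; rewrite addrC subr_eq0.
apply/eqP; apply: eq_bigr => b /andP[ba bna].
by apply: Ldual_stable => //; apply: refines_defect bna _.
Qed.

Lemma L_extension : exists F : {linear QSym K -> V}, forall a, F (L K a) = v a.
Proof.
pose g (a : composition) := Ldual (sumn a - size a) a.
exists (linext g \o @Mcoords K : {linear QSym K -> V}) => a.
rewrite /= /L !linear_sum /= -Ldual_sum; apply: eq_bigr => b _.
by rewrite McoordsM linextU.
Qed.

End LExtension.

Lemma L_extension_uniq (K : fieldType) (V : lmodType K)
  (F G : {linear QSym K -> V}) : (forall a, F (L K a) = G (L K a)) -> F =1 G.
Proof.
move=> FG.
have FGM n (a : composition) : (sumn a - size a <= n)%N -> F (M K a) = G (M K a).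
  elim: n a => [|n IHn] a an; have := FG a; rewrite /L;
    rewrite sum_refines !linearD /=.
    rewrite big_pred0 ?linear0 ?addr0 // => b; apply/negP.
    by move=> /andP[ba bna]; exact: refines_defect0 bna an.
  set s := \sum_(_ <- _ | _) _; suff -> : F s = G s by apply: addIr.
  rewrite /s !linear_sum; apply: eq_bigr => b /andP[ba bna].
  by apply: IHn; apply: refines_defect bna an.
move=> f; rewrite -(McoordsK f) /linext !linear_sum; apply: eq_bigr => a _.
by rewrite !linearZ /= (FGM (sumn a - size a)%N).
Qed.

Section RhoMaxOne.
Variable K : fieldType.

Definition rho : {linear QSym K -> QSym K} :=
  projT1 (cid (L_extension (fun a => L K (crev a)))).

Lemma rho_L a : rho (L K a) = L K (crev a).
Proof. exact: (projT2 (cid (L_extension (fun a => L K (crev a))))). Qed.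

Lemma crevK : involutive crev.
Proof. by move=> a; apply: val_inj; rewrite /= revK. Qed.

Lemma rhoK : involutive rho.
Proof.
have := @L_extension_uniq K _ (rho \o rho : {linear _ -> _}) (idfun : {linear _ -> _}).
by apply=> a /=; rewrite !rho_L crevK.
Qed.

Definition hook_sign (a : composition) : K^o :=
  if [pick k : 'I_(sumn a) | parts a == (sumn a - k)%N :: nseq k 1%N] is Some k
  then (-1) ^+ k else 0.

Definition MaxOne : {linear QSym K -> K^o} :=
  projT1 (cid (L_extension hook_sign)).

Lemma MaxOne_L a : MaxOne (L K a) = hook_sign a.
Proof. exact: (projT2 (cid (L_extension hook_sign))). Qed.

Lemma MaxOne_hook (a : composition) n k : (k < n)%N ->
  a = (n - k)%N :: nseq k 1%N :> seq nat -> MaxOne (L K a) = (-1) ^+ k.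
Proof.
move=> kn aE; have an : sumn a = n by rewrite aE /= sumn_nseq mul1n subnK // ltnW.
rewrite MaxOne_L /hook_sign; case: pickP => [j|/(_ (cast_ord (esym an) (Ordinal kn)))].
  by move=> /eqP/esym jE; have /(congr1 size) := etrans jE aE;
     rewrite /= !size_nseq => -[->].
by rewrite /= an aE eqxx.
Qed.

Lemma MaxOne_nonhook (a : composition) :
  (forall n k, (k < n)%N -> a <> (n - k)%N :: nseq k 1%N :> seq nat) ->
  MaxOne (L K a) = 0.
Proof.
move=> ha; rewrite MaxOne_L /hook_sign; case: pickP => // k /eqP aE.
by case: (ha (sumn a) k).
Qed.

End RhoMaxOne.

(* Main.v *)
(** A linear form on QSym is the same thing as its table of values on the M_a,
i.e. a noncommutative formal power series in letters H_1, H_2, ...; the product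
of series is dual to the coproduct of QSym.  Since a |-> psi_a is compatible
with deconcatenation, reading off the values at the psi_a instead of the M_a is
a ring endomorphism S of series, namely a substitution.  Let H be the sum of 1
and the letters, E the derivation multiplying by the degree, and define the
power sum series Psi by Newton's identity E H = H Psi.  Then S(H) = 1/pi, and
  (a_1 + ... + a_l) / pi(a_1, ..., a_l) = 1 / pi(a_1, ..., a_(l-1))
says that E(1/pi) = (1/pi) X where X is the sum of the letters, so that
S(Psi) = X.  Hence the products Psi_(b_1) ... Psi_(b_l) of homogeneous
components of Psi form the basis dual to the psi_b.  Finally rho is dual to the
reversal of words, which is an anti-automorphism, and MaxOne is the reversal of
Psi: both send M_a to (-1)^(l(a) - 1) a_1. *)

From HB Require Import structures.
Require Import Defs.
From mathcomp Require Import boolp functions.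
From mathcomp Require Import all_boot all_order all_algebra.
From mathcomp Require Import finmap reals complex monalg ring.
Import GRing.Theory Num.Theory.
Set Implicit Arguments.
Unset Strict Implicit.
Unset Printing Implicit Defensive.
Local Open Scope ring_scope.

Definition ncseries (T : Type) (K : Type) : Type := seq T -> K.

Definition ncrev (T K : Type) (f : ncseries T K) : ncseries T K :=
  fun s => f (rev s).

Section NcSeriesRing.
Variables (T : Type) (K : pzSemiRingType).
Implicit Types (f g h : ncseries T K) (s : seq T) (x : T).

HB.instance Definition _ := GRing.Nmodule.copy (ncseries T K) (seq T -> K).

Lemma ncseriesDE f g s : (f + g) s = f s + g s.
Proof. by []. Qed.

Definition ncone : ncseries T K := fun s => (nilp s)%:R.

Definition ncmul f g : ncseries T K := fun s =>
  \sum_(k < (size s).+1) f (take k s) * g (drop k s).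

Definition lderiv x f : ncseries T K := fun s => f (x :: s).

Definition rderiv x f : ncseries T K := fun s => f (rcons s x).

Lemma ncmul_nil f g : ncmul f g [::] = f [::] * g [::].
Proof. by rewrite /ncmul big_ord1. Qed.

Lemma ncmul_cons f g x s :
  ncmul f g (x :: s) = f [::] * g (x :: s) + ncmul (lderiv x f) g s.
Proof. by rewrite /ncmul big_ord_recl. Qed.

Lemma ncmulDl : left_distributive ncmul +%R.
Proof.
move=> f g h; apply/funext => s; rewrite ncseriesDE /ncmul -big_split.
by apply: eq_bigr => k _; apply: mulrDl.
Qed.

Lemma ncmulDr : right_distributive ncmul +%R.
Proof.
move=> f g h; apply/funext => s; rewrite ncseriesDE /ncmul -big_split.
by apply: eq_bigr => k _; apply: mulrDr.
Qed.

Lemma ncmul_scalel c f g :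
  ncmul (fun s => c * f s) g = fun s => c * ncmul f g s.
Proof.
apply/funext => s; rewrite /ncmul mulr_sumr.
by apply: eq_bigr => k _; rewrite mulrA.
Qed.

Lemma lderiv_ncmul x f g :
  lderiv x (ncmul f g) =
  (fun s => f [::] * lderiv x g s) + ncmul (lderiv x f) g.
Proof. by apply/funext => s; rewrite /lderiv ncmul_cons. Qed.

Lemma ncmul0l : left_zero (0 : ncseries T K) ncmul.
Proof. by move=> f; apply/funext => s; apply: big1 => k _; apply: mul0r. Qed.

Lemma ncmul0r : right_zero (0 : ncseries T K) ncmul.
Proof. by move=> f; apply/funext => s; apply: big1 => k _; apply: mulr0. Qed.

Lemma ncmulA : associative ncmul.
Proof.
move=> f g h; apply/funext => s; elim: s f g => [|x s IHs] f g.
  by rewrite !ncmul_nil mulrA.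
rewrite !ncmul_cons ncmul_nil lderiv_ncmul ncmulDl ncmul_scalel ncseriesDE IHs.
by rewrite mulrDr mulrA -addrA.
Qed.

Lemma ncmul1l : left_id ncone ncmul.
Proof.
move=> f; apply/funext => -[|x s]; first by rewrite ncmul_nil mul1r.
by rewrite ncmul_cons mul1r (ncmul0l f : ncmul (lderiv x ncone) f = 0) addr0.
Qed.

Lemma ncmul1r : right_id ncone ncmul.
Proof.
move=> f; apply/funext => s; elim: s f => [|x s IHs] f.
  by rewrite ncmul_nil mulr1.
by rewrite ncmul_cons mulr0 add0r IHs.
Qed.

HB.instance Definition _ := GRing.Nmodule_isPzSemiRing.Build (ncseries T K)
  ncmulA ncmul1l ncmul1r ncmulDl ncmulDr ncmul0l ncmul0r.

Lemma ncseries1E s : (1 : ncseries T K) s = (nilp s)%:R.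
Proof. by []. Qed.

Lemma ncseriesM_nil f g : (f * g) [::] = f [::] * g [::].
Proof. exact: ncmul_nil. Qed.

Lemma ncseriesM_cons f g x s :
  (f * g) (x :: s) = f [::] * g (x :: s) + (lderiv x f * g) s.
Proof. exact: ncmul_cons. Qed.

Lemma ncseriesM_rcons f g s x :
  (f * g) (rcons s x) =
  (f * rderiv x g) s + f (rcons s x) * g [::].
Proof.
elim: s f => [|y s IHs] f; first by rewrite ncseriesM_cons !ncseriesM_nil.
by rewrite rcons_cons !ncseriesM_cons IHs addrA.
Qed.

End NcSeriesRing.

Section Reversal.
Variables (T : Type) (K : comPzSemiRingType).
Implicit Types (f g : ncseries T K) (x : T).

Lemma lderiv_ncrev x f : lderiv x (ncrev f) = ncrev (rderiv x f).
Proof. by apply/funext => s; rewrite /lderiv /ncrev rev_cons. Qed.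

Lemma ncrevM f g : ncrev (f * g) = ncrev g * ncrev f.
Proof.
apply/funext => s; elim: s g => [|x s IHs] g.
  by rewrite {1}/ncrev !ncseriesM_nil mulrC.
rewrite ncseriesM_cons lderiv_ncrev -IHs /ncrev rev_cons ncseriesM_rcons.
by rewrite addrC mulrC.
Qed.

Lemma ncrev_prod (I : Type) (r : seq I) (F : I -> ncseries T K) :
  ncrev (\prod_(i <- r) F i) = \prod_(i <- rev r) ncrev (F i).
Proof.
elim: r => [|i r IHr]; last by rewrite big_cons rev_cons big_rcons ncrevM IHr.
rewrite !big_nil; apply/funext => s.
by rewrite /ncrev !ncseries1E /nilp size_rev.
Qed.

End Reversal.

Section LinearSeries.
Variables (T : Type) (K : pzSemiRingType).
Implicit Types (f : ncseries T K) (w : T -> K) (s : seq T).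

Definition linear_series w : ncseries T K :=
  fun s => if s is [:: x] then w x else 0.

Lemma mul_linear_series_nil f w : (f * linear_series w) [::] = 0.
Proof. by rewrite ncseriesM_nil mulr0. Qed.

Lemma mul_linear_series_rcons f w s x :
  (f * linear_series w) (rcons s x) = f s * w x.
Proof.
elim: s f => [|y s IHs] f; rewrite ncseriesM_cons.
  by rewrite mul_linear_series_nil addr0.
by rewrite IHs; case: (s) => [|z t] /=; rewrite mulr0 add0r.
Qed.

Lemma linear_series_mul_nil f w : (linear_series w * f) [::] = 0.
Proof. by rewrite ncseriesM_nil mul0r. Qed.

Lemma linear_series_mul_cons f w s x :
  (linear_series w * f) (x :: s) = w x * f s.
Proof.
rewrite ncseriesM_cons mul0r add0r.
have -> : lderiv x (linear_series w) = fun t => w x * ncone K t.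
  by apply/funext => -[|y t]; rewrite /ncone ?mulr1 ?mulr0.
by rewrite -[LHS]/(ncmul _ _ s) ncmul_scalel ncmul1l.
Qed.

End LinearSeries.

Section Cuts.
Variable T : Type.

Definition cons_head (x : T) (B : seq (seq T)) : option (seq (seq T)) :=
  if B is u :: B' then Some ((x :: u) :: B') else None.

Fixpoint cuts (s : seq T) : seq (seq (seq T)) :=
  if s is x :: s' then
    [seq [:: x] :: B | B <- cuts s'] ++
    pmap (cons_head x) (cuts s')
  else [:: [::]].

Section SumCuts.
Variable K : pzSemiRingType.
Implicit Types (F G : ncseries (seq T) K) (s : seq T).

Definition sum_cuts F : ncseries T K := fun s => \sum_(B <- cuts s) F B.

Definition enlarge_head x F : ncseries (seq T) K :=
  fun B => oapp F 0 (cons_head x B).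

Lemma sum_cuts_nil F : sum_cuts F [::] = F [::].
Proof. exact: big_seq1. Qed.

Lemma sum_cuts_linear c F G s :
  sum_cuts ((fun B => c * F B) + G) s = c * sum_cuts F s + sum_cuts G s.
Proof. by rewrite /sum_cuts big_split -mulr_sumr. Qed.

Lemma lderiv_sum_cuts x F :
  lderiv x (sum_cuts F) =
  sum_cuts (lderiv [:: x] F) + sum_cuts (enlarge_head x F).
Proof.
apply/funext => s; rewrite ncseriesDE /lderiv /sum_cuts big_cat big_map.
by rewrite big_pmap.
Qed.

Lemma enlarge_head_mul x F G :
  enlarge_head x (F * G) =
  (fun B => F [::] * enlarge_head x G B) + enlarge_head x F * G.
Proof.
apply/funext => -[|u B]; rewrite ncseriesDE /enlarge_head /=.
  by rewrite ncseriesM_nil mulr0 mul0r addr0.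
by rewrite !ncseriesM_cons /= mul0r add0r.
Qed.

(* [lderiv [:: x]] and [enlarge_head x] obey the same twisted Leibniz rule as
   [lderiv x], to which [sum_cuts] relates their sum.                         *)
Lemma sum_cutsM F G : sum_cuts (F * G) = sum_cuts F * sum_cuts G.
Proof.
apply/funext => s; elim: s F => [|x s IHs] F.
  by rewrite ncseriesM_nil !sum_cuts_nil ncseriesM_nil.
rewrite ncseriesM_cons lderiv_sum_cuts mulrDl ncseriesDE -!IHs sum_cuts_nil.
rewrite -[LHS]/(lderiv x (sum_cuts (F * G)) s) lderiv_sum_cuts ncseriesDE.
rewrite -[sum_cuts G _]/(lderiv x (sum_cuts G) s) lderiv_sum_cuts ncseriesDE.
rewrite enlarge_head_mul (lderiv_ncmul [:: x] F G) !sum_cuts_linear.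
by rewrite addrACA mulrDr.
Qed.

Lemma sum_cuts_one_block F x s : (forall u v B, F [:: u, v & B] = 0) ->
  sum_cuts F (x :: s) = F [:: x :: s].
Proof.
elim: s x F => [|y s IHs] x F F0.
  by rewrite /sum_cuts /= big_seq1.
rewrite -[LHS]/(lderiv x (sum_cuts F) (y :: s)) lderiv_sum_cuts ncseriesDE.
rewrite !IHs => [|u v B|u v B]; rewrite ?/lderiv /enlarge_head /= ?F0 //.
by rewrite add0r.
Qed.

End SumCuts.

End Cuts.

Lemma mem_cuts (T : eqType) (s : seq T) B :
  (B \in cuts s) = (flatten B == s) && ([::] \notin B).
Proof.
elim: s B => [|x s IHs] B; first by case: B => [|[|y u] B]; rewrite ?inE ?andbF.
rewrite mem_cat mem_pmap; apply/orP/andP => [[]/mapP[C]|].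
- by rewrite IHs => /andP[/eqP <- C0] ->; rewrite inE /= eqxx.
- rewrite IHs; case: C => [|u C] // /andP[/eqP <- uC0] [->].
  by move: uC0; rewrite !inE /= eqxx; case/norP.
case: B => [|[|y [|z u]] B]; rewrite ?inE => -[] //= /eqP[-> Bs] B0.
  by left; apply: map_f; rewrite IHs Bs eqxx.
by right; apply/mapP; exists ((z :: u) :: B); rewrite // IHs inE /= Bs eqxx.
Qed.

Lemma uniq_cuts (T : eqType) (s : seq T) : uniq (cuts s).
Proof.
elim: s => [//|x s IHs] /=; rewrite cat_uniq map_inj_uniq => [|B C []//].
pose uncons_head (B : seq (seq T)) := behead (head [::] B) :: behead B.
rewrite IHs (@pmap_uniq _ _ _ uncons_head) ?andbT //.
  apply/hasPn => B; rewrite mem_pmap => /mapP[[//|u C] Cs [->]].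
  apply/mapP => -[D _ [uE _]]; move: Cs; rewrite mem_cuts uE.
  by rewrite inE andbF.
by case.
Qed.

Section BlockSubstitution.
Variables (T U : Type) (K : comPzSemiRingType).
Variables (sigma : seq T -> U) (p : seq T -> K).
Implicit Types h : ncseries U K.

Definition block_weighted h : ncseries (seq T) K :=
  fun B => \prod_(u <- B) p u * h [seq sigma u | u <- B].

(* Substitutes in [h], for each letter [n], the series with coefficient [p u]
   at the nonempty words [u] such that [sigma u = n].                         *)
Definition block_subst h : ncseries T K := sum_cuts (block_weighted h).

Lemma block_weightedM h1 h2 :
  block_weighted (h1 * h2) = block_weighted h1 * block_weighted h2.
Proof.
apply/funext => B; rewrite -[RHS]/(ncmul _ _ B) /block_weighted.
rewrite -[(h1 * h2) _]/(ncmul _ _ _) /ncmul size_map mulr_sumr.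
apply: eq_bigr => k _; rewrite -map_take -map_drop mulrACA -big_cat /=.
by rewrite cat_take_drop.
Qed.

Lemma block_subst_is_nmod_morphism : nmod_morphism block_subst.
Proof.
split=> [|h1 h2]; apply/funext => s; rewrite /block_subst /sum_cuts.
  by apply: big1 => B _; apply: mulr0.
by rewrite ncseriesDE -big_split; apply: eq_bigr => B _; apply: mulrDr.
Qed.

Lemma block_subst_is_monoid_morphism : monoid_morphism block_subst.
Proof.
split=> [|h1 h2]; last by rewrite /block_subst block_weightedM sum_cutsM.
apply/funext => -[|x s].
  by rewrite /block_subst sum_cuts_nil /block_weighted big_nil mul1r.
rewrite /block_subst sum_cuts_one_block /block_weighted ?mulr0 // => u v B.
exact: mulr0.
Qed.

HB.instance Definition _ := GRing.isNmodMorphism.Build (ncseries U K)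
  (ncseries T K) block_subst block_subst_is_nmod_morphism.
HB.instance Definition _ := GRing.isMonoidMorphism.Build (ncseries U K)
  (ncseries T K) block_subst block_subst_is_monoid_morphism.

Lemma block_subst_linear_series w s : block_subst (linear_series w) s =
  if nilp s then 0 else p s * w (sigma s).
Proof.
case: s => [|x s]; rewrite /block_subst.
  by rewrite sum_cuts_nil /block_weighted mulr0.
rewrite sum_cuts_one_block /block_weighted ?big_seq1 // => u v B.
exact: mulr0.
Qed.

End BlockSubstitution.

Section Grading.
Variable K : pzSemiRingType.
Implicit Types (c w : nat -> K) (f : ncseries nat K).

Definition grade_scale c f : ncseries nat K := fun s => c (sumn s) * f s.

Lemma grade_scale_linear_series c w :
  grade_scale c (linear_series w) = linear_series (fun n => c n * w n).
Proof.
apply/funext => -[|n [|m s]]; rewrite /grade_scale /= ?mulr0 //.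
by rewrite addn0.
Qed.

Lemma ncrev_grade_scale c f : ncrev (grade_scale c f) = grade_scale c (ncrev f).
Proof. by apply/funext => s; rewrite /grade_scale /ncrev sumn_rev. Qed.

Definition homog n f := grade_scale (fun m => (m == n)%:R) f.

Lemma homog_linear_series n w :
  homog n (linear_series w) = linear_series (fun m => (m == n)%:R * w n).
Proof.
rewrite /homog grade_scale_linear_series; congr linear_series.
by apply/funext => m; case: eqP => [->|]; rewrite ?mul0r.
Qed.

Lemma prod_letters (b s : seq nat) :
  (\prod_(n <- b) linear_series (fun m => (m == n)%:R : K)) s = (s == b)%:R.
Proof.
elim: b s => [|n b IHb] [|x s]; rewrite ?big_nil ?ncseries1E //.
  by rewrite big_cons linear_series_mul_nil.
by rewrite big_cons linear_series_mul_cons IHb eqseq_cons -natrM mulnb.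
Qed.

End Grading.

Lemma block_subst_grade_scale (K : comPzSemiRingType) (p : seq nat -> K) c f :
  block_subst sumn p (grade_scale c f) = grade_scale c (block_subst sumn p f).
Proof.
apply/funext => s; rewrite /grade_scale /block_subst /sum_cuts mulr_sumr.
apply: eq_big_seq => B; rewrite mem_cuts => /andP[/eqP <- _].
by rewrite /block_weighted -sumn_flatten mulrCA.
Qed.

Section PowerSum.
Variable K : pzRingType.

Definition complete : ncseries nat K := 1 + linear_series (fun=> 1).

Definition alternating : ncseries nat K := fun s => (-1) ^+ size s.

Lemma alternatingM_complete : alternating * complete = 1.
Proof.
rewrite mulrDr mulr1; apply/funext => s; rewrite ncseriesDE.
case: (lastP s) => [|t x]; first by rewrite mul_linear_series_nil addr0.
rewrite mul_linear_series_rcons ncseries1E /nilp /alternating size_rcons.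
by rewrite exprS mulN1r mulr1 addNr.
Qed.

Lemma grade_scale_complete :
  grade_scale (fun n => n%:R) complete = linear_series (fun n => n%:R).
Proof.
apply/funext => -[|n [|m s]]; rewrite /grade_scale /complete ncseriesDE.
- by rewrite mul0r.
- by rewrite add0r mulr1 /= addn0.
- by rewrite addr0 mulr0.
Qed.

(* Newton's identities [n H_n = \sum_k H_(n - k) Psi_k] for the noncommutative
   power sums read [complete * powersum = grade_scale (fun n => n%:R) complete];
   solve for [powersum] with the two lemmas above.                            *)
Definition powersum : ncseries nat K :=
  alternating * linear_series (fun n => n%:R).

Lemma ncrev_powersum_cons x s :
  ncrev powersum (x :: s) = (-1) ^+ size s * x%:R.
Proof.
by rewrite /ncrev rev_cons [LHS]mul_linear_series_rcons /alternating size_rev.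
Qed.

End PowerSum.

Lemma pi1_rcons s x : pi1 (rcons s x) = (pi1 s * (sumn s + x))%N.
Proof.
rewrite /pi1 size_rcons big_nat_recr //= take_oversize ?size_rcons //.
rewrite sumn_rcons; congr (_ * _)%N; apply: eq_big_nat => i /andP[_ le_is].
by rewrite -cats1 takel_cat.
Qed.

Lemma pi1_gt0 s : all (leq 1) s -> (0 < pi1 s)%N.
Proof.
elim/last_ind: s => [|s x IHs]; first by rewrite /pi1 big_nil.
rewrite all_rcons pi1_rcons muln_gt0 addn_gt0 => /andP[-> /IHs ->].
by rewrite orbT.
Qed.

Section InversePi.
Variable K : numFieldType.

(* Killing the words with a letter 0 makes [grade_scale_inv_pi], which fails for
   [1 / pi1] at [[:: 1; 0]], an identity of series over the alphabet [nat].   *)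
Definition inv_pi : ncseries nat K :=
  fun s => (all (leq 1) s)%:R / (pi1 s)%:R.

Lemma inv_pi_nil : inv_pi [::] = 1.
Proof. by rewrite /inv_pi /pi1 big_nil divr1. Qed.

Lemma grade_scale_inv_pi : grade_scale (fun n => n%:R) inv_pi =
  inv_pi * linear_series (fun n => (0 < n)%:R).
Proof.
apply/funext => s; case: (lastP s) => [|t x].
  by rewrite mul_linear_series_nil /grade_scale mul0r.
rewrite mul_linear_series_rcons /grade_scale /inv_pi sumn_rcons all_rcons.
rewrite pi1_rcons natrM; case: x => [|x]; first by rewrite mulr0 mul0r mulr0.
rewrite mulr1 invfM mulrCA [X in _ * X]mulrCA divff ?mulr1 //.
by rewrite pnatr_eq0 addnS.
Qed.

Lemma block_subst_complete : block_subst sumn inv_pi (complete K) = inv_pi.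
Proof.
rewrite rmorphD rmorph1 /=; apply/funext => s.
rewrite ncseriesDE ncseries1E block_subst_linear_series.
case: nilP => [->|_]; first by rewrite addr0 inv_pi_nil.
by rewrite add0r mulr1.
Qed.

Lemma block_subst_powersum :
  block_subst sumn inv_pi (powersum K) = linear_series (fun n => (0 < n)%:R).
Proof.
rewrite rmorphM -grade_scale_complete /= block_subst_grade_scale.
rewrite block_subst_complete grade_scale_inv_pi mulrA.
rewrite -{2}block_subst_complete -rmorphM.
by rewrite alternatingM_complete rmorph1 mul1r.
Qed.

Definition psi_dual (b : seq nat) : ncseries nat K :=
  \prod_(n <- b) homog n (powersum K).

Lemma block_subst_psi_dual b s : all (leq 1) b ->
  block_subst sumn inv_pi (psi_dual b) s = (s == b)%:R.
Proof.
move=> b0; rewrite rmorph_prod -(prod_letters K b s).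
congr (_ s); apply: eq_big_seq => n bn.
rewrite [LHS]block_subst_grade_scale block_subst_powersum.
rewrite -/(homog _ _) homog_linear_series; congr linear_series.
by apply/funext => m; rewrite (allP b0 n bn) mulr1.
Qed.

End InversePi.

Section LinearExtensionTheory.
Variables (K : fieldType) (B : choiceType) (V : lmodType K).
Implicit Types (v : B -> V) (x : {malg K[B]}).

Lemma eq_linext v1 v2 : v1 =1 v2 -> linext v1 =1 linext v2.
Proof. by move=> eq_v x; apply: eq_bigr => b _; rewrite eq_v. Qed.

Lemma linear_linext (W : lmodType K) (F : {linear V -> W}) v x :
  F (linext v x) = linext (F \o v) x.
Proof.
by rewrite /linext linear_sum; apply: eq_bigr => b _; rewrite linearZ.
Qed.

Lemma linext_monomial v c b : linext v << c *g b >> = c *: v b.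
Proof.
rewrite -[v b]linextU -linearZ; congr linext.
by apply/malgP => b'; rewrite mcoeffZ !mcoeffU mulr_natr.
Qed.

Lemma linext_delta x b : linext (fun b' => (b' == b)%:R : K^o) x = x@_b.
Proof.
rewrite (linextEw _ (fsubsetUr [fset b]%fset (msupp x))).
rewrite (big_fsetD1 b) ?fset1U1 //= eqxx [X in X + _]mulr1 big1_fset ?addr0 //.
by move=> b'; rewrite in_fsetD1 => /andP[/negPf -> _] _; apply: mulr0.
Qed.

Definition spanned v : {pred V} := fun y => `[< exists x, y = linext v x >].

Lemma spanned_submod_closed v : submod_closed (spanned v).
Proof.
split=> [|c _ _ /asboolP[x ->] /asboolP[y ->]]; apply/asboolP.
  by exists 0; rewrite linear0.
by exists (c *: x + y); rewrite linearP.
Qed.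

HB.instance Definition _ v :=
  GRing.isSubmodClosed.Build K V (spanned v) (spanned_submod_closed v).

Lemma spanned_linext v e x :
  (forall b, e b \in spanned v) -> linext e x \in spanned v.
Proof. by move=> ev; apply: rpred_sum => b _; apply/rpredZ/ev. Qed.

Lemma spanned_triangular v e (mu : B -> nat) (d : B -> K)
    (r : B -> seq B) (P : B -> pred B) (F : B -> B -> K) :
  (forall b, d b != 0) -> (forall b b', P b b' -> mu b' < mu b)%N ->
  (forall b, v b = d b *: e b + \sum_(b' <- r b | P b b') F b b' *: e b') ->
  forall b, e b \in spanned v.
Proof.
move=> d0 muP vE b; have [n] := ubnP (mu b).
elim: n b => // n IHn b /ltnSE le_bn.
have v_spanned : v b \in spanned v.
  by apply/asboolP; exists << b >>; rewrite linextU.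
rewrite -[e b](scalerK (d0 b)) rpredZ //.
rewrite -(addrK (\sum_(b' <- r b | P b b') F b b' *: e b') (d b *: e b)) -vE.
apply: rpredB => //; apply: rpred_sum => b' Pb'.
exact/rpredZ/IHn/(leq_trans (muP _ _ Pb')).
Qed.

End LinearExtensionTheory.

Lemma perm_blocks_cuts (a : composition) :
  perm_eq [seq blocks a (parts b) | b <- comps (sumn a) & refines a b] (cuts a).
Proof.
apply: uniq_perm; last 1 first.
- move=> B; rewrite mem_cuts; apply/mapP/andP => [[b]|[/eqP BE B0]].
    rewrite mem_filter => /andP[/andP[aE /eqP bE] _] ->; split=> //.
    apply/negP => /(map_f sumn); rewrite bE => b0.
    by have /allP/(_ _ b0) := parts_gt0 b.
  have a0 : all (leq 1) (flatten B) by rewrite BE parts_gt0.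
  have b0 : all (leq 1) [seq sumn s | s <- B].
    apply/allP => _ /mapP[[|x s] sB ->]; first by rewrite sB in B0.
    apply: ltn_addr; apply: (allP a0).
    by apply/flattenP; exists (x :: s); rewrite ?mem_head.
  exists (Composition b0); last by rewrite /= -BE blocksK.
  rewrite mem_filter mem_comps /= -sumn_flatten BE eqxx andbT.
  by apply/refinesP; exists B.
- rewrite map_inj_in_uniq ?filter_uniq ?uniq_comps // => b c.
  rewrite !mem_filter => /andP[/andP[_ /eqP bE] _] /andP[/andP[_ /eqP cE] _] bc.
  by apply: val_inj; rewrite /= -bE -cE bc.
- exact: uniq_cuts.
Qed.

Lemma blocks_gt0 (a b : composition) s :
  refines a b -> s \in blocks a b -> all (leq 1) s.
Proof.
case/andP => /eqP aE _ sB; apply/allP => x xs; apply: (allP (parts_gt0 a)).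
by rewrite -aE; apply/flattenP; exists s.
Qed.

Lemma pi2_gt0 (a b : composition) : refines a b -> (0 < pi2 a b)%N.
Proof.
move=> ab; rewrite /pi2 big_seq prodn_cond_gt0 // => s sB.
exact/pi1_gt0/(blocks_gt0 ab sB).
Qed.

Lemma refines_crev (a b : composition) :
  refines (crev a) (crev b) = refines a b.
Proof.
suff refines_rev c d : refines c d -> refines (crev c) (crev d).
  by apply/idP/idP => /refines_rev //; rewrite !crevK.
case/refinesP => B [cE dE]; apply/refinesP; exists (rev (map rev B)) => /=.
rewrite -rev_flatten cE; split=> //; rewrite map_rev -map_comp -dE.
by congr rev; apply: eq_map => s; apply: sumn_rev.
Qed.

Lemma perm_comps_crev n : perm_eq [seq crev b | b <- comps n] (comps n).
Proof.
apply: uniq_perm; rewrite ?(map_inj_uniq (inv_inj crevK)) ?uniq_comps // => b.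
by rewrite -{1}(crevK b) (mem_map (inv_inj crevK)) !mem_comps sumn_rev.
Qed.

Section Pairing.
Variable K : fieldType.
Implicit Types (f : ncseries nat K) (a b : composition) (x : QSym K).

Definition pairing f : {linear QSym K -> K^o} :=
  linext (fun a => f (parts a) : K^o) \o @Mcoords K.

Lemma pairing_M f a : pairing f (M K a) = f a.
Proof. by rewrite /= McoordsM linextU. Qed.

Lemma eq_linear_M (V : lmodType K) (F G : {linear QSym K -> V}) :
  (forall a, F (M K a) = G (M K a)) -> F =1 G.
Proof.
by move=> FG x; rewrite -(McoordsK x) !linear_linext; apply: eq_linext.
Qed.

Lemma pairing1 x : pairing 1 x = Mcoef x cnil.
Proof.
rewrite -McoordsE -linext_delta; apply: eq_linext => a.
by rewrite ncseries1E /nilp size_eq0.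
Qed.

Lemma rho_M a : rho K (M K a) = M K (crev a).
Proof.
pose F : {linear QSym K -> QSym K} := linext (M K \o crev) \o @Mcoords K.
have FM b : F (M K b) = M K (crev b) by rewrite /= McoordsM linextU.
rewrite -FM; apply: L_extension_uniq => {}a; rewrite rho_L /L linear_sum.
under [RHS]eq_bigr do rewrite FM.
rewrite sumn_rev -(perm_big _ (perm_comps_crev (sumn a))) big_map.
by apply: eq_bigl => b; rewrite refines_crev.
Qed.

Lemma pairing_rho f x : pairing f (rho K x) = pairing (ncrev f) x.
Proof.
apply: (eq_linear_M (F := pairing f \o rho K)) => a.
by rewrite -[LHS]/(pairing f (rho K (M K a))) rho_M !pairing_M.
Qed.

End Pairing.

Fixpoint refinements (s : seq nat) : seq (seq nat) :=
  if s is x :: s' then [seq u ++ v | u <- compseqs x, v <- refinements s']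
  else [:: [::]].

Lemma refinementsP s t :
  reflect
    (all (leq 1) t /\ exists B, flatten B = t /\ [seq sumn u | u <- B] = s)
    (t \in refinements s).
Proof.
elim: s t => [|x s IHs] t /=.
  rewrite inE; apply: (iffP eqP) => [->|[_ [[|u B] [<- //]]]].
  by split=> //; exists [::].
apply: (iffP allpairsP) => [[[u v] /= [ux /IHs[v0 [B [Bv Bs]]] ->]]|].
  move: ux; rewrite mem_compseqs => /andP[u0 /eqP ux].
  by rewrite all_cat u0 v0; split=> //; exists (u :: B); rewrite /= Bv Bs ux.
case=> t0 [[|u B] [//= tE [ux Bs]]]; exists (u, flatten B) => /=.
move: t0; rewrite -tE all_cat mem_compseqs ux eqxx => /andP[-> B0].
by split=> //; apply/IHs; split=> //; exists B.
Qed.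

Lemma uniq_refinements s : uniq (refinements s).
Proof.
elim: s => [//|x s IHs] /=; apply: allpairs_uniq => //.
  exact: uniq_compseqs.
move=> [u v] [u' v'] /allpairsP[[w z] [wx _ [-> ->]]] {u v}.
move=> /allpairsP[[w' z'] [wx' _ [-> ->]]] {u' v'} /= eq_cat.
move: wx wx'; rewrite !mem_compseqs /= => /andP[w0 /eqP wx] /andP[w0' /eqP wx'].
by rewrite -(cut_sum_cat z w0) -(cut_sum_cat z' w0') eq_cat wx wx'.
Qed.

Lemma perm_parts_refinements (a : composition) :
  perm_eq [seq parts b | b <- comps (sumn a) & refines b a] (refinements a).
Proof.
apply: uniq_perm; last 1 first.
- move=> s; apply/mapP/refinementsP => [[b]|[s0 [B [sE aE]]]].
    rewrite mem_filter => /andP[/refinesP ba _] ->; split=> //.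
    exact: parts_gt0.
  exists (Composition s0) => //; rewrite mem_filter mem_comps /= -aE.
  by rewrite -sumn_flatten sE eqxx andbT; apply/refinesP; exists B.
- by rewrite (map_inj_uniq val_inj) filter_uniq // uniq_comps.
- exact: uniq_refinements.
Qed.

Lemma pairing_L (K : fieldType) (f : ncseries nat K) (a : composition) :
  pairing f (L K a) = \sum_(s <- refinements a) f s.
Proof.
rewrite /L linear_sum -(perm_big _ (perm_parts_refinements a)).
by rewrite big_map big_filter; apply: eq_bigr => b _; rewrite pairing_M.
Qed.

Lemma sum_compseqsS (V : nmodType) (F : seq nat -> V) n :
  \sum_(s <- compseqs n.+1) F s =
  \sum_(s <- compseqs n)
    (F (1%N :: s) + if s is x :: t then F (x.+1 :: t) else 0).
Proof.
rewrite big_flatten big_map; apply: eq_bigr => -[|x s] _.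
  by rewrite big_seq1 addr0.
by rewrite big_cons big_seq1.
Qed.

Section SignedSums.
Variable K : comPzRingType.

Lemma sum_compseqs_alternating n : (0 < n)%N ->
  \sum_(u <- compseqs n) alternating K u = - (n == 1)%:R.
Proof.
case: n => // n _; rewrite sum_compseqsS eqSS; case: n => [|n].
  by rewrite big_seq1 addr0 /alternating expr1.
rewrite big_seq big1 ?oppr0 // => -[|x s]; first by rewrite mem_compseqs.
by rewrite /alternating /= !exprS !mulN1r opprK subrr.
Qed.

Lemma sum_compseqs_powersum n :
  \sum_(u <- compseqs n) ncrev (powersum K) u = (0 < n)%:R.
Proof.
elim: n => [|n IHn].
  by rewrite big_seq1 /ncrev /powersum mul_linear_series_nil.
rewrite sum_compseqsS; case: n IHn => [_|n <-].
  by rewrite big_seq1 ncrev_powersum_cons mulr1 addr0.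
rewrite big_seq [RHS]big_seq; apply: eq_bigr => -[|x s].
  by rewrite mem_compseqs.
by move=> _; rewrite !ncrev_powersum_cons /= exprS -natr1; ring.
Qed.

Lemma sum_refinements_alternating s : all (leq 1) s ->
  \sum_(t <- refinements s) alternating K t =
  (-1) ^+ size s * (all (pred1 1%N) s)%:R.
Proof.
elim: s => [_|x s IHs /= /andP[x0 /IHs{}IHs]]; first by rewrite big_seq1 mulr1.
rewrite big_allpairs_dep /=.
transitivity ((\sum_(u <- compseqs x) alternating K u) *
              (\sum_(v <- refinements s) alternating K v)).
  rewrite mulr_suml; apply: eq_bigr => u _.
  rewrite mulr_sumr; apply: eq_bigr => v _.
  by rewrite /alternating size_cat exprD.
rewrite sum_compseqs_alternating // IHs exprS -mulnb natrM.
by rewrite mulrACA mulN1r.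
Qed.

Lemma sum_refinements_powersum x s : all (leq 1) (x :: s) ->
  \sum_(t <- refinements (x :: s)) ncrev (powersum K) t =
  (-1) ^+ size s * (all (pred1 1%N) s)%:R.
Proof.
move=> /= /andP[x0 s0]; rewrite big_allpairs_dep /=.
transitivity ((\sum_(u <- compseqs x) ncrev (powersum K) u) *
              (\sum_(v <- refinements s) alternating K v)).
  rewrite mulr_suml big_seq [RHS]big_seq; apply: eq_bigr => -[|y u].
    by rewrite mem_compseqs => /eqP x_eq0; rewrite -x_eq0 in x0.
  move=> _; rewrite mulr_sumr; apply: eq_bigr => v _.
  by rewrite /= !ncrev_powersum_cons /alternating size_cat exprD mulrAC.
by rewrite sum_compseqs_powersum x0 mul1r sum_refinements_alternating.
Qed.

End SignedSums.

Lemma MaxOne_M (K : fieldType) (a : composition) :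
  MaxOne K (M K a) = ncrev (powersum K) a.
Proof.
rewrite -pairing_M; apply: L_extension_uniq => {}a; rewrite pairing_L.
case: a => -[|x s] xs0.
  rewrite big_seq1 MaxOne_nonhook // /ncrev /powersum.
  by rewrite [RHS]mul_linear_series_nil.
rewrite [parts _]/= sum_refinements_powersum //; case: all_pred1P => [sE|s_ne1].
  rewrite mulr1; apply: (@MaxOne_hook K _ (x + size s)%N); last first.
    by rewrite /= addnK -sE.
  by case/andP: xs0 => x0 _; rewrite -[ltnLHS]add0n ltn_add2r.
rewrite mulr0 MaxOne_nonhook // => n k _ [_ sE]; apply: s_ne1.
by rewrite sE size_nseq.
Qed.

Section TensorPairing.
Variable K : fieldType.
Implicit Types (f : ncseries nat K) (fs : seq (ncseries nat K)) (x : QSym K).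

Definition tensor_pairing l fs : Tens K l -> K^o :=
  linext (fun t : l.-tuple composition =>
    \prod_(p <- zip fs t) p.1 (parts p.2) : K^o).

Lemma tensor_pairing_comul_head l f g fs (y : Tens K l.+1) :
  tensor_pairing (f :: g :: fs) (comul_head y) = tensor_pairing (f * g :: fs) y.
Proof.
rewrite /tensor_pairing /comul_head linear_linext; apply: eq_linext => t.
case/tupleP: t => a t; rewrite /= linear_sum theadE /= big_cons.
rewrite -[(f * g, a).1 _]/(ncmul f g a) mulr_suml; apply: eq_bigr => k _.
by rewrite linextU /= !big_cons mulrA.
Qed.

Lemma tensor_pairing_iter_comul l fs x : size fs = l ->
  tensor_pairing fs (iter_comul l x) = pairing (\prod_(f <- fs) f) x.
Proof.
case: fs l => [|f fs] [|l] // => [_|[]].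
  rewrite big_nil pairing1 /tensor_pairing linext_monomial /= big_nil.
  exact: mulr1.
elim: l f fs => [|l IHl] f [|g fs] // => [_|[size_fs]].
  rewrite big_seq1 /tensor_pairing /= linear_linext; apply: eq_linext => a.
  by rewrite /= linextU /= big_seq1.
rewrite [iter_comul _ _]/= tensor_pairing_comul_head [LHS]IHl //.
by rewrite !big_cons mulrA.
Qed.

Lemma tensor_pairing_homog l f (b : seq nat) (y : Tens K l) : size b = l ->
  tensor_pairing [seq homog n f | n <- b] y =
  linext (fun t : l.-tuple composition =>
    (if [seq sumn c | c : composition <- t] == b
     then \prod_(c <- t) f (parts c) else 0) : K^o) y.
Proof.
move=> size_b; apply: eq_linext => -[t /= /eqP].
elim: b l size_b t {y} => [|n b IHb] [|l] // => [_|[/IHb{}IHb]] [|c t] //=.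
  by rewrite !big_nil.
case=> /IHb; rewrite !big_cons => ->; rewrite eqseq_cons /homog /grade_scale /=.
by case: eqP => _ /=; rewrite ?mul1r ?mul0r //; case: eqP; rewrite ?mulr0.
Qed.

Lemma tens_form_Delta (phi : QSym K -> K) f (b : composition) x :
  (forall a, phi (M K a) = f (parts a)) ->
  tens_form phi (Delta b x) = pairing (\prod_(n <- b) homog n f) x.
Proof.
move=> phiM; rewrite -(big_map (fun n => homog n f) predT idfun).
rewrite -(tensor_pairing_iter_comul (l := size b)) ?size_map //.
rewrite tensor_pairing_homog // /tens_form /Delta /proj_deg linear_linext.
apply: (@eq_linext _ _ K^o) => t /=; case: ifP => _; last by rewrite linear0.
by rewrite linextU; apply: eq_bigr => c _.
Qed.

End TensorPairing.

Section PsiBasis.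
Variable K : numFieldType.
Implicit Types a b : composition.

Lemma pairing_psi (f : ncseries nat K) a :
  pairing f (psi K a) = block_subst sumn (inv_pi K) f a.
Proof.
rewrite linear_sum /block_subst /sum_cuts -(perm_big _ (perm_blocks_cuts a)).
rewrite big_map big_filter; apply: eq_bigr => b ab.
have /andP[_ /eqP bE] := ab.
rewrite linearZ_LR pairing_M /block_weighted bE /pi2 natr_prod -prodfV.
congr (_ * _); apply: eq_big_seq => s sB.
by rewrite /inv_pi (blocks_gt0 ab sB) mul1r.
Qed.

Lemma pairing_psi_dual a b : pairing (psi_dual K b) (psi K a) = (a == b)%:R.
Proof. by rewrite pairing_psi block_subst_psi_dual ?parts_gt0. Qed.

Lemma pairing_psi_dual_linext b c :
  pairing (psi_dual K b) (linext (psi K) c) = c@_b.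
Proof.
rewrite linear_linext -linext_delta; apply: eq_linext => a.
exact: pairing_psi_dual.
Qed.

Lemma psi_leading_term a : psi K a = (pi2 a a)%:R^-1 *: M K a +
  \sum_(b <- comps (sumn a) | refines a b && (a != b)) (pi2 a b)%:R^-1 *: M K b.
Proof.
rewrite /psi big_mkcond (bigD1_seq a) ?mem_comps ?uniq_comps //= refines_refl.
by rewrite -big_mkcondr; under eq_bigl do rewrite andbC eq_sym.
Qed.

Lemma spanned_psi (x : QSym K) : x \in spanned (psi K).
Proof.
rewrite -(McoordsK x); apply: spanned_linext.
apply: (spanned_triangular (mu := fun a : composition => size a) _ _
  psi_leading_term) => [a|a b].
  by rewrite invr_eq0 pnatr_eq0 -lt0n pi2_gt0 ?refines_refl.
by case/andP; apply: refines_size.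
Qed.

Lemma tens_form_MaxOne b x :
  tens_form (MaxOne K) (Delta (crev b) x) = pairing (psi_dual K b) (rho K x).
Proof.
rewrite (tens_form_Delta _ _ (@MaxOne_M K)) pairing_rho ncrev_prod.
congr (pairing _ x); apply: eq_bigr => n _.
by rewrite ncrev_grade_scale.
Qed.

End PsiBasis.

Theorem theorem3p9 (R : realType) (alpha : composition) :
  (exists c : {malg R[i][composition]},
     rho _ (psi R[i] alpha) = \sum_(b <- msupp c) c@_b *: psi R[i] b) /\
  (forall c : {malg R[i][composition]},
     rho _ (psi R[i] alpha) = \sum_(b <- msupp c) c@_b *: psi R[i] b ->
     forall beta : composition,
       c@_beta = tens_form (MaxOne R[i]) (Delta (crev beta) (psi R[i] alpha))).
Proof.
split=> [|c cE beta]; first exact/asboolP/spanned_psi.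
by rewrite tens_form_MaxOne cE pairing_psi_dual_linext.
Qed.
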